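(* For every fixed integer $q\ge 2$, $\Psi(H_{n,q})=(2+o(1))\,n/\log_q n$ as $n\to\infty$.
   Context: The Hamming graph $H_{n,q}$ has vertex set $\{0,1,\dots,q-1\}^n$, two vertices adjacent iff they differ in exactly one coordinate. A set $S$ of vertices of a graph $G$ is doubly resolving if for all distinct vertices $u,v$ there are $x,y\in S$ with $d_G(u,x)-d_G(u,y)\neq d_G(v,x)-d_G(v,y)$; $\Psi(G)$ is the minimum cardinality of a doubly resolving set. *)

(* Defs.v *)
From HB Require Import structures.
From mathcomp Require Import all_boot all_order all_algebra.
From mathcomp Require Import all_classical all_reals all_analysis.

Set Implicit Arguments.
Unset Strict Implicit.
Unset Printing Implicit Defensive.

Import Order.TTheory GRing.Theory Num.Theory.
Import numFieldNormedType.Exports.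

Local Open Scope ring_scope.

Section DoublyResolving.
Variables (T : finType) (e : rel T).

Definition walk_of_length (u v : T) (k : nat) : bool :=
  [exists p : k.-tuple T, path e u p && (last u p == v)].

(* Length of a shortest path from u to v. A shortest path has length < #|T|,
   so searching the lengths 0, ..., #|T| - 1 suffices; the value is #|T| when
   v is not reachable from u. *)
Definition gdist (u v : T) : nat :=
  find (walk_of_length u v) (iota 0 #|T|).

Definition doubly_resolving (S : {set T}) : bool :=
  [forall u, forall v, (u != v) ==>
    [exists x in S, exists y in S,
      (gdist u x)%:Z - (gdist u y)%:Z != (gdist v x)%:Z - (gdist v y)%:Z]].

(* In a connected graph the full vertex set is doubly resolving (take x = u and
   y = v), so the default value #|T| does not affect the minimum. *)
Definition Psi : nat :=
  \big[minn/#|T|]_(S : {set T} | doubly_resolving S) #|S|.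

End DoublyResolving.

Definition hamming_graph (n q : nat) : rel {ffun 'I_n -> 'I_q} :=
  fun u v => #|[set i | u i != v i]| == 1%N.

Definition log_base {R : realType} (b x : R) : R := ln x / ln b.

(* Main.v *)
Require Import Defs.
From HB Require Import structures.
From mathcomp Require Import all_boot all_order all_algebra.
From mathcomp Require Import all_classical all_reals all_analysis.
From mathcomp Require Import zify ring lra.
Import mathcomp.boot.fintype mathcomp.boot.finset.

(** Lower bound: for a uniformly random word [u] the distances from [u] to the
    members of a doubly resolving set [S] have variance at most [n].  By convexity
    the Gaussian weight of the vector of distances is on average at least
    [expR (- #|S|)], whereas the total weight of all integer vectors is
    [O (sqrt n) ^ #|S|]; as the vector determines [u], this yields
    [q ^ n <= O (sqrt n) ^ #|S|].

    Upper bound: a variant of Lindstrom's detecting matrices.  Coordinates are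
    labelled by a block, a set [S] included in ['I_k] and a digit position [j];
    the queries of a block are indexed by the subsets [A] of ['I_k], and the letter
    queried at a coordinate depends on [A :&: S] only.  The alternating sum of the
    answers over the subsets [A] of [S] kills the labels that do not contain [S],
    and on the label [S] itself it is an affine function of the digit of weight
    [q ^ j]; digits are thus recovered from the largest [S] downwards.  An
    alternating sum does not see additive constants, so this set of queries is even
    doubly resolving. *)

Set Implicit Arguments.
Unset Strict Implicit.
Unset Printing Implicit Defensive.

Import Order.TTheory GRing.Theory Num.Theory.
Import numFieldNormedType.Exports.

Local Open Scope ring_scope.

(** * The Hamming metric *)

Section HammingDistance.
Variables n q : nat.
Implicit Types u v w x : {ffun 'I_n -> 'I_q}.

Definition hdist u v : nat := #|[set i | u i != v i]|.

Lemma hdistC u v : hdist u v = hdist v u.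
Proof. by rewrite /hdist; apply: eq_card => i; rewrite !inE eq_sym. Qed.

Lemma hdistE u v : hdist u v = (\sum_i (u i != v i))%N.
Proof.
rewrite /hdist -sum1_card big_mkcond; apply: eq_bigr => i _.
by rewrite inE; case: ifP.
Qed.

Lemma hdist_le u v : (hdist u v <= n)%N.
Proof. by rewrite -[n in (_ <= n)%N]card_ord max_card. Qed.

Lemma hdist_eq0 u v : (hdist u v == 0%N) = (u == v).
Proof.
rewrite /hdist cards_eq0; apply/eqP/eqP => [h|->].
  apply/ffunP => i; apply/eqP/negPn/negP => ui.
  have : i \in (set0 : {set 'I_n}) by rewrite -h inE ui.
  by rewrite inE.
by apply/setP => i; rewrite !inE eqxx.
Qed.

Lemma hdist_triangle u v w : (hdist u w <= hdist u v + hdist v w)%N.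
Proof.
rewrite !hdistE -big_split /=; apply: leq_sum => i _.
by case: (eqVneq (u i) (v i)) => [->|_]; case: eqVneq.
Qed.

Lemma hdist_le_walk u v k :
  walk_of_length (@hamming_graph n q) u v k -> (hdist u v <= k)%N.
Proof.
case/existsP => p /andP[]; case: p => s /= /eqP <- {k}.
elim: s u => [|w s IH] u /=; first by move=> _ /eqP ->; rewrite leqn0 hdist_eq0.
case/andP => /eqP uw ws ls; apply: leq_trans (hdist_triangle u w v) _.
by rewrite [hdist u w]uw add1n ltnS IH.
Qed.

Lemma walk_hdist u v : walk_of_length (@hamming_graph n q) u v (hdist u v).
Proof.
move hk : (hdist u v) => k; elim: k u hk => [|k IH] u hk.
  apply/existsP; exists [tuple]; rewrite /=; move/eqP: hk.
  by rewrite hdist_eq0.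
have /card_gt0P[i] : (0 < #|[set i | u i != v i]|)%N by rewrite -/(hdist u v) hk.
rewrite inE => ui.
pose w := [ffun j => if j == i then v i else u j].
have hw : hdist w v = k.
  move: hk; rewrite /hdist (cardsD1 i) inE ui add1n => -[<-].
  apply: eq_card => j; rewrite !inE ffunE.
  by case: (eqVneq j i) => [->|]; rewrite ?eqxx.
have /existsP[p /andP[pw lw]] := IH w hw.
apply/existsP; exists [tuple of w :: p]; rewrite /= pw lw !andbT.
rewrite /hamming_graph; apply/cards1P; exists i; apply/setP => j.
rewrite !inE ffunE; case: (eqVneq j i) => [->|]; by rewrite ?ui ?eqxx.
Qed.

Lemma gdist_hamming u v : (1 < q)%N -> gdist (@hamming_graph n q) u v = hdist u v.
Proof.
move=> q1; rewrite /gdist.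
(* [gdist] searches only lengths below the number of vertices; the distance is in range because
   [n < q ^ n]. *)
have hn : (hdist u v < #|{ffun 'I_n -> 'I_q}|)%N.
  by rewrite card_ffun !card_ord (leq_ltn_trans (hdist_le u v)) // ltn_expl.
have hh : has (walk_of_length (@hamming_graph n q) u v)
    (iota 0 #|{ffun 'I_n -> 'I_q}|).
  apply/hasP; exists (hdist u v); last exact: walk_hdist.
  by rewrite mem_iota /= add0n.
apply/eqP; rewrite eqn_leq; apply/andP; split.
  rewrite leqNgt; apply/negP => /(before_find 0%N).
  by rewrite nth_iota // add0n walk_hdist.
have /hdist_le_walk := nth_find 0%N hh.
by rewrite nth_iota ?add0n // -[X in (_ < X)%N](size_iota 0) -has_find.
Qed.

End HammingDistance.

Section PsiBounds.
Variables (T : finType) (e : rel T).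

Lemma Psi_le (S : {set T}) : doubly_resolving e S -> (Psi e <= #|S|)%N.
Proof.
rewrite /Psi => dS; have : S \in index_enum {set T} by rewrite mem_index_enum.
elim: (index_enum _) => // A s IH; rewrite inE big_cons => /orP[/eqP <-|/IH le].
  by rewrite dS geq_minl.
by case: ifP => // _; rewrite (leq_trans _ le) ?geq_minr.
Qed.

Lemma Psi_attained : doubly_resolving e [set: T] ->
  exists2 S : {set T}, doubly_resolving e S & #|S| = Psi e.
Proof.
rewrite /Psi => dT.
apply: (@big_ind _ (fun m => exists2 S, doubly_resolving e S & #|S| = m)).
(* The default value of the minimum is the cardinality of the full vertex set. *)
- by exists [set: T] => //; rewrite cardsT.
- by move=> a b ? ?; rewrite /minn; case: ifP.
- by move=> S dS; exists S.
Qed.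

End PsiBounds.

Lemma doubly_resolving_hammingP n q (S : {set {ffun 'I_n -> 'I_q}}) :
  (1 < q)%N ->
  reflect (forall u v, u != v -> exists x y, [/\ x \in S, y \in S &
      (hdist u x)%:Z - (hdist u y)%:Z != (hdist v x)%:Z - (hdist v y)%:Z])
    (doubly_resolving (@hamming_graph n q) S).
Proof.
move=> q1; apply: (iffP forallP) => h u; [move=> v uv|apply/forallP => v].
  have /forallP/(_ v) := h u; rewrite uv /= => /existsP[x /andP[xS]].
  case/existsP => y /andP[yS]; rewrite !gdist_hamming // => ?.
  by exists x, y.
apply/implyP => /h[x [y [xS yS hxy]]].
apply/existsP; exists x; rewrite xS; apply/existsP; exists y; rewrite yS /=.
by rewrite !gdist_hamming.
Qed.

Lemma doubly_resolving_hammingT n q : (1 < q)%N ->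
  doubly_resolving (@hamming_graph n q) [set: {ffun 'I_n -> 'I_q}].
Proof.
move=> q1; apply/doubly_resolving_hammingP => // u v uv.
exists u, v; split; rewrite ?inE //.
have huu w : hdist w w = 0%N :> nat by apply/eqP; rewrite hdist_eq0.
rewrite !huu [hdist v u]hdistC; move: uv; rewrite -hdist_eq0; lia.
Qed.

(** * Lindstrom's construction *)

Section Alternating.
Variable T : finType.
Implicit Types A B S : {set T}.

(** Toggling a point of [S] outside [S'] flips the sign and leaves [A :&: S'] unchanged, so the
    terms cancel in pairs. *)
Lemma sum_sign_subsets_setI S S' (F : {set T} -> int) :
  ~~ (S \subset S') ->
  \sum_(A : {set T} | A \subset S) (-1) ^+ #|A| * F (A :&: S') = 0.
Proof.
case/subsetPn => i iS iS'.
pose flip A := if i \in A then A :\ i else i |: A.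
have flipK : involutive flip.
  move=> A; rewrite /flip; case: (boolP (i \in A)) => iA.
    by rewrite !inE eqxx /= setD1K.
  by rewrite !inE eqxx /= setU1K ?iA.
have flipS A : (flip A \subset S) = (A \subset S).
  rewrite /flip; case: ifP => iA; last by rewrite subUset sub1set iS.
  apply/idP/idP => [h|]; last by apply: subset_trans; rewrite subD1set.
  by rewrite -(setD1K iA) subUset sub1set iS.
have flipI A : flip A :&: S' = A :&: S'.
  rewrite /flip; case: ifP => _; apply/setP => j; rewrite !inE.
    by case: (eqVneq j i) => [->|] //=; rewrite (negPf iS') andbF.
  by case: (eqVneq j i) => [->|] //=; rewrite (negPf iS') !andbF.
have flip_sign A : (-1) ^+ #|flip A| = - (-1) ^+ #|A| :> int.
  rewrite /flip; case: ifP => iA; last by rewrite cardsU1 iA exprS mulN1r.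
  by rewrite (cardsD1 i A) iA exprS mulN1r opprK.
set s := LHS; suff : s = - s by lia.
rewrite {1}/s (reindex_inj (inv_inj flipK)) /= -sumrN.
apply: eq_big => [A|A _]; first by rewrite flipS.
by rewrite flip_sign flipI mulNr.
Qed.

Lemma sum_sign_subsets S : S != set0 ->
  \sum_(A : {set T} | A \subset S) (-1) ^+ #|A| = 0 :> int.
Proof.
move=> S0; rewrite -[RHS](@sum_sign_subsets_setI S set0 (fun=> 1)).
  by apply: eq_bigr => A _; rewrite mulr1.
by rewrite subset0.
Qed.

Lemma card_subsets_parity S b : S != set0 ->
  #|[set A in powerset S | odd #|A| == b]| = (2 ^ #|S|.-1)%N.
Proof.
move=> S0; pose E b := [set A in powerset S | odd #|A| == b].
have eqE : #|E false| = #|E true|.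
  have /eqP := sum_sign_subsets S0.
  rewrite (bigID (fun A : {set T} => odd #|A|)) /=.
  rewrite (eq_bigr (fun=> -1)); last by move=> A /andP[_ oA]; rewrite -signr_odd oA.
  rewrite (eq_bigr (fun=> 1) (P := fun A => (A \subset S) && ~~ odd #|A|)); last first.
    by move=> A /andP[_ /negPf oA]; rewrite -signr_odd oA.
  rewrite !sumr_const addrC mulNrn subr_eq0 => /eqP/eqP; rewrite eqr_nat => /eqP.
  by congr (_ = _); apply: eq_card => A; rewrite !inE unfold_in /= ?eqb_id ?eqbF_neg.
have sE : (#|E false| + #|E true| = 2 ^ #|S|)%N.
  rewrite -card_powerset -(cardsID [set A : {set T} | ~~ odd #|A|] (powerset S)).
  congr (_ + _)%N; apply: eq_card => A; rewrite !inE.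
    by rewrite eqbF_neg.
  by rewrite negbK eqb_id andbC.
have S1 : (0 < #|S|)%N by rewrite card_gt0.
move: sE; rewrite -(prednK S1) expnS /= -/(E b).
by case: b; rewrite -?eqE ?eqE; lia.
Qed.

Lemma sum_index_enum (X : {set {set T}}) (f : nat -> int) :
  \sum_(A in X) f (index A (enum X)) = \sum_(0 <= t < #|X|) f t.
Proof.
rewrite -[LHS]big_enum /= (big_nth set0) -cardE.
apply: eq_big_nat => t /andP[_ tX].
by rewrite index_uniq ?enum_uniq // -cardE.
Qed.

(** Even subsets of [S], in order of enumeration, receive the letters [al 0, al 1, ...] and odd ones
    [be 0, be 1, ...]. Each parity class has [2 ^ #|S|.-1] members, whence the bound on [M]; members
    of rank at least [M] all receive [c0] and cancel between the classes. *)
Lemma exists_signed_fibers S q (al be : nat -> 'I_q) (M : nat) (c0 : 'I_q) :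
  S != set0 -> (M <= 2 ^ #|S|.-1)%N ->
  exists h : {set T} -> 'I_q, forall c : 'I_q,
   \sum_(A : {set T} | A \subset S) (-1) ^+ #|A| * (h A == c)%:Z =
   \sum_(0 <= t < M) ((al t == c)%:Z - (be t == c)%:Z).
Proof.
move=> S0 hM; pose E b := [set A in powerset S | odd #|A| == b].
pose g b t := if (t < M)%N then (if b then be t else al t) else c0.
exists (fun A => g (odd #|A|) (index A (enum (E (odd #|A|))))) => c.
rewrite (bigID (fun A : {set T} => odd #|A|)) /=.
have part b : \sum_(A : {set T} | (A \subset S) && (odd #|A| == b)) (-1) ^+ #|A| *
     (g (odd #|A|) (index A (enum (E (odd #|A|)))) == c)%:Z =
     (-1) ^+ b * \sum_(0 <= t < 2 ^ #|S|.-1) (g b t == c)%:Z.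
  rewrite -(card_subsets_parity b S0) -(sum_index_enum _ (fun t => (g b t == c)%:Z)).
  rewrite mulr_sumr; apply: eq_big => [A|A /andP[_ /eqP <-]]; first by rewrite !inE.
  by rewrite signr_odd.
rewrite (eq_bigl _ _ (fun A => congr1 (andb _) (esym (eqb_id _)))) part.
rewrite (eq_bigl _ _ (fun A => congr1 (andb _) (esym (eqbF_neg _)))) part.
rewrite expr0 mul1r expr1 mulN1r addrC -sumrB.
rewrite (big_cat_nat _ (n := M)) //= [X in _ + X = _]big_nat [X in _ + X = _]big1 ?addr0.
  by apply: eq_big_nat => t /andP[_ tM]; rewrite /g tM.
by move=> t /andP[Mt _]; rewrite /g ltnNge Mt /= subrr.
Qed.

End Alternating.

(** * Base-[q] digits and the queries built from them *)

Lemma sum_nat_divn_modn (F : nat -> nat -> int) (a b : nat) : (0 < b)%N ->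
  \sum_(0 <= t < a * b) F (t %% b)%N (t %/ b)%N =
  \sum_(0 <= i < a) \sum_(0 <= r < b) F r i.
Proof.
move=> b0; elim: a => [|a IH]; first by rewrite mul0n !big_geq.
rewrite (big_cat_nat _ (n := (a * b)%N)) //= ?leq_mul2r ?leqnSn ?orbT // IH.
rewrite big_nat_recr //=; congr (_ + _).
rewrite -{1}[(a * b)%N]add0n big_addn mulSn addnK.
apply: eq_big_nat => t /andP[_ tb]; rewrite addnC modnMDl modn_small //.
by rewrite divnMDl // divn_small // addn0.
Qed.

Lemma sum_nat_modn (f : nat -> int) (a b : nat) : (0 < b)%N ->
  \sum_(0 <= t < a * b) f (t %% b)%N = (\sum_(0 <= r < b) f r) *+ a.
Proof.
move=> b0; rewrite (sum_nat_divn_modn (fun r _ => f r)) //.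
by rewrite sumr_const_nat subn0.
Qed.

(* The letter [r %% q] is uniform on a period of length [q ^ 2], whereas the
   frequency of [c] as a minimum of two letters is affine in [c]. *)
Lemma sum_uniform_sub_min (q : nat) (c : 'I_q) :
  \sum_(0 <= r < q * q)
    ((r %% q == c)%N%:Z - (minn (r %% q) (r %/ q) == c)%N%:Z)
  = c%:Z *+ 2 - q%:Z + 1.
Proof.
have q0 : (0 < q)%N := leq_ltn_trans (leq0n c) (ltn_ord c).
rewrite (@sum_nat_divn_modn (fun r i => (r == c)%N%:Z - (minn r i == c)%N%:Z)) //.
have inner i Q : \sum_(0 <= r < Q) ((r == c)%N%:Z - (minn r i == c)%N%:Z) =
    ((c < Q)%N : nat)%:Z - (if (i < c)%N then 0%N else if i == c then (Q - c)%N
       else ((c < Q)%N : nat))%:Z.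
  elim: Q => [|Q IH]; first by rewrite big_geq //; case: (ltngtP i c); lia.
  rewrite big_nat_recr //= IH; case: (ltngtP i c); lia.
under eq_bigr => i _ do rewrite inner (ltn_ord c).
have outer Q : \sum_(0 <= i < Q) ((1%N)%:Z - (if (i < c)%N then 0%N
     else if i == c then (q - c)%N else 1%N)%:Z) =
    (minn Q c)%:Z + (if (c < Q)%N then 1 - (q - c)%N%:Z else 0).
  elim: Q => [|Q IH]; first by rewrite big_geq //= min0n.
  rewrite big_nat_recr //= IH ltnS; case: (ltngtP Q c); lia.
rewrite outer (ltn_ord c); have := ltn_ord c; lia.
Qed.

Lemma digit_label_neq0 (T : finType) (S : {set T}) (q j : nat) :
  (1 < q)%N -> (q ^ j.+2 <= 2 ^ #|S|.-1)%N -> S != set0.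
Proof.
move=> q1 hM; apply/eqP => S0; move: hM.
(* The truncated predecessor of 0 is 0, so the right-hand side is 1. *)
rewrite S0 cards0 /= leqNgt => /negP; apply.
by rewrite expn0 -{1}(exp1n j.+2) ltn_exp2r.
Qed.

(** Even subsets carry the lowest base-[q] digit of their rank, odd ones the minimum of its two
    lowest digits. The [q ^ j.+2] ranks form [q ^ j] periods of length [q * q], each contributing
    the affine function of [sum_uniform_sub_min]. *)
Lemma exists_digit_fibers (T : finType) (S : {set T}) (q j : nat) :
  (1 < q)%N -> (q ^ j.+2 <= 2 ^ #|S|.-1)%N ->
  exists h : {set T} -> 'I_q, forall c : 'I_q,
   \sum_(A : {set T} | A \subset S) (-1) ^+ #|A| * (h A == c)%:Z =
   (c%:Z *+ 2 - q%:Z + 1) * (q ^ j)%:Z.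
Proof.
move=> q1 hM; have q0 : (0 < q)%N := ltnW q1.
have S0 := digit_label_neq0 q1 hM.
have minq r : (minn (r %% q) ((r %/ q) %% q) < q)%N.
  by rewrite gtn_min ltn_pmod.
have [h hE] := @exists_signed_fibers T S q
  (fun t => Ordinal (ltn_pmod t q0)) (fun t => Ordinal (minq t)) _ (Ordinal q0) S0 hM.
exists h => c; rewrite {}hE.
pose f r : int := (r %% q == c)%N%:Z - (minn (r %% q) (r %/ q) == c)%N%:Z.
have -> : (q ^ j.+2 = q ^ j * (q * q))%N by rewrite !expnSr mulnA.
rewrite -(sum_uniform_sub_min c) -/f mulrC -(natz (q ^ j)) mulr_natl.
rewrite -sum_nat_modn ?muln_gt0 ?q0 //.
apply: eq_bigr => t _; rewrite /f -!val_eqE /= modn_divl.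
by rewrite modn_dvdm ?dvdn_mulr.
Qed.

(** The nonzero digit at the lowest position would be divisible by [q], since all others carry a
    higher power of [q]; its absolute value is too small for that. *)
Lemma digits_unique (I : finType) (P : pred I) (q : nat) (j : I -> nat) (w : I -> int) :
  (1 < q)%N -> {in P &, injective j} -> (forall i, P i -> `|w i| < q%:Z) ->
  \sum_(i | P i) w i * (q ^ j i)%:Z = 0 -> forall i, P i -> w i = 0.
Proof.
move=> q1 jI wq s0 i Pi; apply/eqP/negPn/negP => wi.
have q0 : (0 < q)%N := ltnW q1.
have Qi : P i && (w i != 0) by rewrite Pi.
case: (@arg_minnP I i (fun i => P i && (w i != 0)) j Qi) => i0 /andP[Pi0 wi0] imin.
have : (q%:Z %| w i0)%Z.
  have qj : (q ^ j i0)%:Z != 0 by rewrite eqz_nat expn_eq0 negb_and -lt0n q0.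
  rewrite -(dvdz_mul2r qj).
  move: s0; rewrite (bigD1 i0) //= => /eqP; rewrite addr_eq0 => /eqP ->.
  rewrite rpredN; apply: rpred_sum => k /andP[Pk ki0].
  have [->|wk] := eqVneq (w k) 0; first by rewrite mul0r rpred0.
  have lk : (j i0 < j k)%N.
    rewrite ltn_neqAle imin ?Pk ?wk // andbT; apply: contra_neq ki0 => e.
    exact: jI.
  by apply: dvdz_mull; rewrite -PoszM -expnS; apply: dvdn_exp2l.
move: (wq i0 Pi0) wi0; rewrite /dvdz unfold_in /= => h1 h2 /dvdn_leq h3; lia.
Qed.

Lemma lindstrom_doubly_resolving n q B k (b : 'I_n -> 'I_B) (S : 'I_n -> {set 'I_k})
    (j : 'I_n -> nat) :
  (1 < q)%N -> injective (fun i => (b i, S i, j i)) ->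
  (forall i, q ^ (j i).+2 <= 2 ^ #|S i|.-1)%N ->
  exists2 X : {set {ffun 'I_n -> 'I_q}},
    doubly_resolving (@hamming_graph n q) X & (#|X| <= B * 2 ^ k)%N.
Proof.
move=> q1 inj hj; have q0 : (0 < q)%N := ltnW q1.
have S0 i := digit_label_neq0 q1 (hj i).
have [h hE] := choice (fun i => exists_digit_fibers q1 (hj i)).
(* Coordinates outside the queried block get a fixed letter, so the alternating sum over a nonempty
   set kills them. *)
pose row (p : 'I_B * {set 'I_k}) : {ffun 'I_n -> 'I_q} :=
  [ffun i => if b i == p.1 then h i (p.2 :&: S i) else Ordinal q0].
exists [set row p | p in [set: 'I_B * {set 'I_k}]]; last first.
  apply: leq_trans (leq_imset_card _ _) _.
  by rewrite cardsT card_prod card_ord -cardsT -powersetT card_powerset cardsT card_ord.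
apply/doubly_resolving_hammingP => // u v uv; apply: contrapT => no.
(* If [u] and [v] are not separated, [D] is constant over all queries, so its alternating sums over
   nonempty sets vanish. *)
pose D p : int := (hdist u (row p))%:Z - (hdist v (row p))%:Z.
have eqD p p' : D p = D p'.
  suff : (hdist u (row p))%:Z - (hdist u (row p'))%:Z =
         (hdist v (row p))%:Z - (hdist v (row p'))%:Z by rewrite /D; lia.
  apply/eqP; apply: contrapT => /negP ne; apply: no.
  by exists (row p), (row p'); split => //; apply: imset_f; rewrite inE.
have [i1 ui1] : exists i, u i != v i.
  apply/existsP; rewrite -negb_forall; apply: contra uv => /forallP e.
  by apply/eqP/ffunP => i; apply/eqP.
(* Take a largest label among the coordinates where [u] and [v] differ: any other label at such a
   coordinate fails to contain it. *)
case: (@arg_maxnP _ i1 (fun i => u i != v i) (fun i => #|S i|) ui1) => i0 ui0 imax.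
pose I i := (b i == b i0) && (S i == S i0).
have DE p : D p = \sum_i ((v i == row p i)%:Z - (u i == row p i)%:Z).
  rewrite /D !hdistE !(big_morph Posz PoszD (erefl _)) -sumrB.
  by apply: eq_bigr => i _; do 2!case: eqP.
have s0 : \sum_(A : {set 'I_k} | A \subset S i0) (-1) ^+ #|A| * D (b i0, A) = 0.
  under eq_bigr => A _ do rewrite (eqD _ (b i0, set0)).
  by rewrite -mulr_suml sum_sign_subsets ?mul0r.
have col i : \sum_(A : {set 'I_k} | A \subset S i0)
    (-1) ^+ #|A| * ((v i == row (b i0, A) i)%:Z - (u i == row (b i0, A) i)%:Z) =
    if I i then 2%:Z * (((v i)%:Z - (u i)%:Z) * (q ^ j i)%:Z) else 0.
  have [uvi|uvi] := eqVneq (u i) (v i).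
    rewrite uvi subrr mul0r mulr0 if_same big1 // => A _.
    by rewrite subrr mulr0.
  rewrite /I; case: (eqVneq (b i) (b i0)) => [bi|bi] /=; last first.
    under eq_bigr => A _ do rewrite ffunE /= (negPf bi).
    by rewrite -mulr_suml sum_sign_subsets ?mul0r.
  case: (eqVneq (S i) (S i0)) => [Si|Si]; last first.
    under eq_bigr => A _ do rewrite ffunE /= bi eqxx.
    apply: (@sum_sign_subsets_setI _ (S i0) (S i)
      (fun A => (v i == h i A)%:Z - (u i == h i A)%:Z)).
    apply: contra Si => sub; rewrite eq_sym eqEcard sub.
    exact: imax.
  (* Here [A :&: S i = A], so the fibre counts of [h i] apply; their additive constants cancel
     between [v i] and [u i]. *)
  transitivity (\sum_(A : {set 'I_k} | A \subset S i)
      ((-1) ^+ #|A| * (h i A == v i)%:Z - (-1) ^+ #|A| * (h i A == u i)%:Z)).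
    rewrite Si; apply: eq_bigr => A AS.
    rewrite ffunE /= bi eqxx Si (setIidPl AS) mulrBr.
    by rewrite [v i == _]eq_sym [u i == _]eq_sym.
  rewrite sumrB !hE; ring.
move: s0; under eq_bigr => A _ do rewrite DE mulr_sumr.
rewrite exchange_big /=; under eq_bigr => i _ do rewrite col.
(* Only coordinates with the block and set of [i0] survive; their digit positions are distinct, so
   [digits_unique] applies. *)
rewrite -big_mkcond /= -mulr_sumr => /eqP; rewrite mulf_eq0 /= => /eqP sum0.
have := @digits_unique _ I q j (fun i => (v i)%:Z - (u i)%:Z) q1 _ _ sum0 i0.
rewrite /I !eqxx => /(_ _ _ isT) vu.
have : (v i0)%:Z - (u i0)%:Z = 0.
  apply: vu => [i i' /andP[/eqP bi /eqP Si] /andP[/eqP bi' /eqP Si'] ji|i _].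
    by apply: inj; rewrite bi Si bi' Si' ji.
  have := ltn_ord (v i); have := ltn_ord (u i); lia.
move/subr0_eq => -[vui]; move: ui0; rewrite eq_sym.
by rewrite (ord_inj vui) eqxx.
Qed.

(** For [q > 1], the number of positions [j] with [q ^ j.+2 <= 2 ^ s.-1]. *)
Definition lindstrom_digits (q s : nat) : nat := (trunc_log q (2 ^ s.-1)).-1.

(** The number of coordinates that one block of [2 ^ k] queries can handle. *)
Definition lindstrom_size (q k : nat) : nat :=
  (\sum_(S : {set 'I_k}) lindstrom_digits q #|S|)%N.

Lemma Psi_hamming_le n q B k : (1 < q)%N -> (n <= B * lindstrom_size q k)%N ->
  (Psi (@hamming_graph n q) <= B * 2 ^ k)%N.
Proof.
move=> q1 hn.
pose C := {S : {set 'I_k} & 'I_(lindstrom_digits q #|S|)}.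
have cardBC : #|{: 'I_B * C}| = (B * lindstrom_size q k)%N.
  rewrite card_prod card_ord card_tagged sumnE big_map big_enum /=; congr (_ * _)%N.
  by apply: eq_bigr => S _; rewrite card_ord.
have hn' : (n <= #|{: 'I_B * C}|)%N by rewrite cardBC.
pose loc (i : 'I_n) : 'I_B * C := enum_val (widen_ord hn' i).
have locI : injective loc.
  by move=> i i' /enum_val_inj/(congr1 val)/= /val_inj.
have injC : injective (fun i => ((loc i).1, tag (loc i).2, tagged (loc i).2 : nat)).
  move=> i i' e; apply: locI; move: e.
  case: (loc i) => b [S j]; case: (loc i') => b' [S' j'] /= [-> eS].
  by case: _ / eS j' => j' /val_inj ->.
have digits i : (q ^ (tagged (loc i).2).+2 <= 2 ^ #|tag (loc i).2|.-1)%N.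
  case: (loc i).2 => S j /=; have := ltn_ord j.
  rewrite /lindstrom_digits => hj.
  apply: (@leq_trans (q ^ trunc_log q (2 ^ #|S|.-1))).
    by rewrite leq_exp2l // -ltn_predRL.
  by apply: trunc_logP; rewrite ?expn_gt0.
have [X dX cX] := lindstrom_doubly_resolving q1 injC digits.
exact: leq_trans (Psi_le dX) cX.
Qed.

(** * The second moment lower bound *)

Section Variance.
Variables (R : realType) (n q : nat).
Hypothesis q0 : (0 < q)%N.
Implicit Types u x : {ffun 'I_n -> 'I_q}.

(** Centred indicator of disagreement: a uniform letter differs from [x i] with probability
    [(q - 1) / q]. *)
Let dev x i (c : 'I_q) : R := (c != x i)%:R - (q%:R - 1) / q%:R.

Let qR0 : q%:R != 0 :> R. Proof. by rewrite pnatr_eq0 -lt0n. Qed.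

Lemma sum_dev x i : \sum_c dev x i c = 0.
Proof.
rewrite sumrB sumr_const card_ord -[X in _ - X]mulr_natr divfK //.
rewrite -natr_sum (bigD1 (x i)) //= eqxx add0n (eq_bigr (fun=> 1%N)); last first.
  by move=> c ->.
rewrite sum_nat_const muln1 cardC1 card_ord -subn1 natrB // subrr //.
Qed.

Lemma dev_sqr_le1 x i c : dev x i c ^+ 2 <= 1.
Proof.
have q0R : 0 < q%:R :> R by rewrite ltr0n.
have p0 : 0 <= (q%:R - 1) / q%:R :> R by rewrite divr_ge0 ?subr_ge0 ?ler1n // ltW.
have p1 : (q%:R - 1) / q%:R <= 1 :> R by rewrite ler_pdivrMr // mul1r lerBlDr lerDl.
rewrite /dev; case: (c != x i) => /=; nra.
Qed.

(** Independence of coordinates: the sum over words is a product of sums over letters, and the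
    factor at [i] vanishes. *)
Lemma sum_dev_cross x i k : i != k ->
  \sum_(u : {ffun 'I_n -> 'I_q}) dev x i (u i) * dev x k (u k) = 0.
Proof.
move=> ik; pose F a c := if a == i then dev x i c else if a == k then dev x k c else 1.
transitivity (\sum_(u : {ffun 'I_n -> 'I_q}) \prod_a F a (u a)).
  apply: eq_bigr => u _; rewrite (bigD1 i) //= (bigD1 k) /=; last by rewrite eq_sym.
  rewrite /F eqxx eq_sym (negPf ik) eqxx big1 ?mulr1 // => a /andP[ai ak].
  by rewrite (negPf ai) (negPf ak).
rewrite -(bigA_distr_bigA F) (bigD1 i) //= /F eqxx sum_dev mul0r //.
Qed.

Lemma sum_hdist_dev x :
  \sum_(u : {ffun 'I_n -> 'I_q})
    ((hdist u x)%:R - n%:R * ((q%:R - 1) / q%:R)) ^+ 2 <= n%:R * (q ^ n)%:R :> R.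
Proof.
have -> : \sum_(u : {ffun 'I_n -> 'I_q})
     ((hdist u x)%:R - n%:R * ((q%:R - 1) / q%:R)) ^+ 2 =
   \sum_(u : {ffun 'I_n -> 'I_q}) \sum_i \sum_k dev x i (u i) * dev x k (u k).
  apply: eq_bigr => u _.
  have -> : (hdist u x)%:R - n%:R * ((q%:R - 1) / q%:R) = \sum_i dev x i (u i).
    by rewrite sumrB sumr_const card_ord [n%:R * _]mulr_natl hdistE natr_sum.
  rewrite expr2 mulr_suml; apply: eq_bigr => i _; rewrite mulr_sumr.
  by [].
rewrite exchange_big /= mulr_natl -[X in _ *+ X]card_ord -sumr_const.
apply: ler_sum => i _; rewrite exchange_big /= (bigD1 i) //= [X in _ + X]big1 ?addr0.
  have -> : (q ^ n)%:R = \sum_(u : {ffun 'I_n -> 'I_q}) 1 :> R.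
    by rewrite sumr_const card_ffun !card_ord.
  by apply: ler_sum => u _; rewrite -expr2 dev_sqr_le1.
by move=> k ki; rewrite sum_dev_cross // eq_sym.
Qed.

End Variance.

(** * Gaussian weights and the counting inequality *)

Lemma sum_geometric_abs (R : realFieldType) (t : R) (N M : nat) : 0 <= t <= 1 ->
  (1 - t) * \sum_(0 <= a < M) t ^+ ((a - N) + (N - a)) <= 2.
Proof.
move=> /andP[t0 t1].
(* The exponent is the distance from [a] to [N]. The bound is sharpened for induction on [M], with
   separate forms before and after [N]. *)
suff : (1 - t) * \sum_(0 <= a < M) t ^+ ((a - N) + (N - a)) <=
    if (M <= N)%N then t ^+ (N - M).+1 else 2 - t ^+ (M - N).
  move/le_trans; apply; case: ifP => _; last by rewrite gerBl exprn_ge0.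
  by apply: le_trans (exprn_ile1 _ t0 t1) _; rewrite ler1n.
elim: M => [|M IH]; first by rewrite big_geq // mulr0 leq0n exprn_ge0.
rewrite big_nat_recr //= mulrDr; move: IH.
set s := (1 - t) * _; case: (ltngtP M N) => MN.
- have -> : ((M - N) + (N - M) = N - M)%N by lia.
  have -> : ((N - M).+1 = (N - M.+1).+2)%N by lia.
  have -> : (N - M = (N - M.+1).+1)%N by lia.
  by rewrite !exprS; lra.
  have -> : ((M - N) + (N - M) = M - N)%N by lia.
  by rewrite subSn ?(ltnW MN) // exprS; lra.
- rewrite MN subnn addn0 subSn // subnn expr0 expr1; lra.
Qed.

(** Domination by two geometric series of ratio [t = expR (- r^-1)] around the integer part [N] of
    [mu]. The factor [expR 2] pays 1 for [y ^+ 2 >= |y| - 1] and 1 for replacing [mu] by [N]. *)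
Lemma sum_gauss_le (R : realType) (n : nat) (mu : R) : (0 < n)%N -> 0 <= mu ->
  \sum_(a < n.+1) expR (- ((a%:R - mu) ^+ 2 / n%:R)) <= 4 * expR 2 * Num.sqrt n%:R.
Proof.
move=> n0 mu0; set r := Num.sqrt n%:R.
have r1 : 1 <= r by rewrite -sqrtr1 ler_sqrt ?ler0n // ler1n.
have r0 : 0 < r := lt_le_trans ltr01 r1.
have rn : n%:R = r ^+ 2 by rewrite sqr_sqrtr // ler0n.
pose N := Num.truncn mu; have /andP[N1 N2] := truncn_itv mu0.
rewrite -/N in N1 N2.
pose t := expR (- r^-1).
have ri : 0 < r^-1 by rewrite invr_gt0.
have tE : t * (1 + r^-1) <= 1.
  rewrite /t expRN -[leRHS](mulVf (lt0r_neq0 (expR_gt0 r^-1))).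
  by rewrite ler_pM2l ?invr_gt0 ?expR_gt0 // expR_ge1Dx.
have t0 : 0 <= t by exact: expR_ge0.
have term (a : nat) : expR (- ((a%:R - mu) ^+ 2 / n%:R)) <=
    expR 2 * t ^+ ((a - N) + (N - a)).
  rewrite -expRM_natl -expRD ler_expR rn.
  set y := (a%:R - mu) / r.
  have -> : (a%:R - mu) ^+ 2 / r ^+ 2 = y ^+ 2 by rewrite exprMn exprVn.
  have ya : a%:R - mu = y * r by rewrite divfK ?gt_eqF.
  have ri1 : r^-1 <= 1 by rewrite invf_le1.
  have rr : r * r^-1 = 1 by rewrite mulfV ?gt_eqF.
  rewrite -addn1 natrD in N2.
  case: (leqP N a) => Na.
    have -> : ((a - N) + (N - a) = a - N)%N by lia.
    rewrite natrB //.
    suff : (a%:R - N%:R) * r^-1 <= y + r^-1 by nra.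
    have -> : y + r^-1 = (a%:R - mu + 1) * r^-1 by rewrite mulrDl mul1r.
    rewrite ler_pM2r //; lra.
  have -> : ((a - N) + (N - a) = N - a)%N by lia.
  rewrite natrB ?(ltnW Na) //.
  suff : (N%:R - a%:R) * r^-1 <= - y by nra.
  have -> : - y = (- (a%:R - mu)) * r^-1 by rewrite mulNr.
  rewrite ler_pM2r //; lra.
rewrite -(big_mkord xpredT (fun a => expR (- ((a%:R - mu) ^+ 2 / n%:R)))).
apply: le_trans (ler_sum _ (fun a _ => term a)) _.
rewrite -mulr_sumr [4 * _]mulrC -mulrA ler_pM2l ?expR_gt0 //.
have t1 : t <= 1 by rewrite /t -expR0 ler_expR oppr_le0 ltW.
have := @sum_geometric_abs R t N n.+1; rewrite t0 t1 => /(_ isT).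
set s := \sum_(_ <= _ < _) _ => hs.
have s0 : 0 <= s by apply: sumr_ge0 => a _; rewrite exprn_ge0.
(* Thus [1 <= (1 - t) * (r + 1)]; the constant 4 comes from the bound 2 on the geometric series and
   from [r + 1 <= 2 * r]. *)
have tr : t * (r + 1) <= r.
  have -> : r + 1 = (1 + r^-1) * r by rewrite mulrDl mul1r mulVf ?gt_eqF.
  by rewrite mulrA -[leRHS]mul1r ler_pM2r.
have : s <= (1 - t) * s * (r + 1) by nra.
nra.
Qed.

Lemma resolving_count (R : realType) n q (S : {set {ffun 'I_n -> 'I_q}}) :
  (0 < q)%N -> (0 < n)%N ->
  (forall u v, {in S, forall x, hdist u x = hdist v x} -> u = v) ->
  (q ^ n)%:R * expR (- #|S|%:R) <= (4 * expR 2 * Num.sqrt n%:R) ^+ #|S| :> R.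
Proof.
move=> q0 n0 res; set mu : R := n%:R * ((q%:R - 1) / q%:R).
have mu0 : 0 <= mu.
  by rewrite mulr_ge0 ?divr_ge0 ?subr_ge0 ?ler1n.
have nR : 0 < n%:R :> R by rewrite ltr0n.
pose w (a : nat) : R := expR (- ((a%:R - mu) ^+ 2 / n%:R)).
pose Y (u : {ffun 'I_n -> 'I_q}) : R := \sum_(x in S) ((hdist u x)%:R - mu) ^+ 2 / n%:R.
have Ysum : \sum_(u : {ffun 'I_n -> 'I_q}) Y u <= #|S|%:R * (q ^ n)%:R.
  rewrite exchange_big /= mulr_natl -sumr_const; apply: ler_sum => x _.
  rewrite -mulr_suml ler_pdivrMr // [leRHS]mulrC.
  exact: sum_hdist_dev.
apply: (@le_trans _ _ (\sum_(u : {ffun 'I_n -> 'I_q}) expR (- Y u))).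
  (* Tangent line of the exponential at [- #|S|]; the linear terms have nonnegative sum since [Y]
     has mean at most [#|S|]. *)
  apply: (@le_trans _ _ (\sum_(u : {ffun 'I_n -> 'I_q})
      expR (- #|S|%:R) * (1 + (#|S|%:R - Y u)))).
    rewrite -mulr_sumr mulrC ler_pM2l ?expR_gt0 // big_split /= sumrB.
    rewrite !sumr_const card_ffun !card_ord -[#|S|%:R *+ _]mulr_natr.
    by rewrite lerDl subr_ge0.
  apply: ler_sum => u _.
  have -> : expR (- Y u) = expR (- #|S|%:R) * expR (#|S|%:R - Y u).
    by rewrite -expRD; congr expR; ring.
  by rewrite ler_pM2l ?expR_gt0 // expR_ge1Dx.
apply: (@le_trans _ _ ((\sum_(a < n.+1) w a) ^+ #|S|)); last first.
  apply: lerXn2r; last exact: sum_gauss_le.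
    by rewrite nnegrE sumr_ge0 // => a _; rewrite expR_ge0.
  by rewrite nnegrE !mulr_ge0 ?expR_ge0 ?sqrtr_ge0.
(* Since [code] is injective, the sum over words is part of the expansion of the power over all
   vectors with entries at most [n]. *)
pose code (u : {ffun 'I_n -> 'I_q}) : {ffun 'I_#|S| -> 'I_n.+1} :=
  [ffun s => inord (hdist u (enum_val s))].
have codeE u s : code u s = hdist u (enum_val s) :> nat.
  by rewrite ffunE inordK // ltnS hdist_le.
have codeI : injective code.
  move=> u v uv; apply: res => x xS.
  have [s ->] : exists s : 'I_#|S|, x = enum_val s.
    by exists (enum_rank_in xS x); rewrite enum_rankK_in.
  by rewrite -!codeE uv.
pose G (f : {ffun 'I_#|S| -> 'I_n.+1}) : R := \prod_s w (f s).
have YG u : expR (- Y u) = G (code u).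
  rewrite /Y -sumrN expR_sum big_enum_val /=; apply: eq_bigr => s _.
  by rewrite codeE.
under eq_bigr => u _ do rewrite YG.
have -> : (\sum_(a < n.+1) w a) ^+ #|S| = \sum_f G f.
  by rewrite -[in LHS](card_ord #|S|) -prodr_const bigA_distr_bigA.
rewrite [leRHS](bigID (fun f => f \in [set code u | u in [set: {ffun 'I_n -> 'I_q}]])) /=.
rewrite big_imset; last by move=> u v _ _; exact: codeI.
rewrite [X in _ <= X + _](eq_bigl xpredT) ?lerDl; last by move=> u; rewrite inE.
by apply: sumr_ge0 => f _; apply: prodr_ge0 => s _; exact: expR_ge0.
Qed.

(** Logarithm of [resolving_count], which applies because equal distances to [S] give equal
    differences. The last factor is [1 + ln (4 * expR 2 * sqrt n)]. *)
Lemma Psi_hamming_ge (R : realType) n q : (1 < q)%N -> (0 < n)%N ->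
  n%:R * ln q%:R <= (Psi (@hamming_graph n q))%:R * (3 + ln 4 + ln n%:R / 2) :> R.
Proof.
move=> q1 n0; have q0 := ltnW q1.
have [S dS <-] := Psi_attained (doubly_resolving_hammingT n q1).
have /resolving_count : forall u v, {in S, forall x, hdist u x = hdist v x} -> u = v.
  move=> u v uv; apply/eqP/negPn/negP.
  move=> /((doubly_resolving_hammingP _ q1 dS) u v)[x [y [xS yS]]].
  by rewrite !uv // eqxx.
move=> /(_ R q0 n0) h.
have qR : 0 < q%:R :> R by rewrite ltr0n.
have nR : 0 < n%:R :> R by rewrite ltr0n.
have sR : 0 < Num.sqrt n%:R :> R by rewrite sqrtr_gt0.
have K0 : 0 < 4 * expR 2 * Num.sqrt n%:R :> R by rewrite !mulr_gt0 ?expR_gt0.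
have lns : ln (Num.sqrt n%:R) = ln n%:R / 2 :> R.
  have := lnXn 2 sR; rewrite sqr_sqrtr ?(ltW nR) // => ->.
  by rewrite -[ln _ *+ 2]mulr_natr mulfK ?pnatr_eq0.
move: h; rewrite -ler_ln ?posrE ?mulr_gt0 ?expR_gt0 ?exprn_gt0 ?ltr0n ?expn_gt0 ?q0 //.
rewrite lnXn // !lnM ?posrE ?mulr_gt0 ?expR_gt0 ?ltr0n ?expn_gt0 ?q0 //.
rewrite !expRK natrX lnXn // lns -[ln _ *+ n]mulr_natl -[_ *+ #|S|]mulr_natl; lra.
Qed.

(** * Asymptotics *)

Lemma sum_card_subsets k : (2 * \sum_(S : {set 'I_k}) #|S| = k * 2 ^ k)%N.
Proof.
rewrite mul2n -addnn [X in (_ + X)%N](reindex_inj (@setC_inj _)) -big_split /=.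
under eq_bigr => S _ do rewrite cardsC card_ord.
by rewrite sum_nat_const -cardsT -powersetT card_powerset cardsT card_ord mulnC.
Qed.

(** Rounding the logarithm and taking predecessors costs at most [ln 2 + 2 * ln q], and
    [ln 2 <= ln q]. *)
Lemma lindstrom_digits_ge (R : realType) q s : (1 < q)%N ->
  s%:R * ln 2 - 3 * ln q%:R <= (lindstrom_digits q s)%:R * ln q%:R :> R.
Proof.
move=> q1; have lnq : 0 < ln q%:R :> R by rewrite ln_gt0 // ltr1n.
have lnq2 : ln 2 <= ln q%:R :> R by rewrite ler_ln ?posrE ?ltr0n ?ler_nat // ltnW.
set t := trunc_log q (2 ^ s.-1).
have h : s.-1%:R * ln 2 <= t.+1%:R * ln q%:R :> R.
  rewrite !mulr_natl -!lnXn ?ltr0n ?(ltnW q1) //.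
  rewrite ler_ln ?posrE ?exprn_gt0 ?ltr0n ?(ltnW q1) //.
  by rewrite -!natrX ler_nat ltnW // trunc_log_ltn.
have s1 : s%:R <= s.-1%:R + 1 :> R by rewrite natr1 ler_nat; lia.
have t1 : t.+1%:R <= t.-1%:R + 2 :> R by rewrite -natrD ler_nat; lia.
have ln2 : 0 < ln 2 :> R by rewrite ln_gt0 // ltr1n.
rewrite /lindstrom_digits -/t; nra.
Qed.

Lemma lindstrom_size_ge (R : realType) q k : (1 < q)%N ->
  (2 ^ k)%:R * (k%:R * ln 2 - 6 * ln q%:R) <=
  2 * ((lindstrom_size q k)%:R * ln q%:R) :> R.
Proof.
move=> q1; rewrite /lindstrom_size natr_sum mulr_suml.
apply: le_trans (_ : 2 * \sum_(S : {set 'I_k}) (#|S|%:R * ln 2 - 3 * ln q%:R) <= _).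
  rewrite sumrB -mulr_suml -natr_sum sumr_const.
  rewrite -cardsT -powersetT card_powerset cardsT card_ord.
  have hc : 2 * (\sum_(S : {set 'I_k}) #|S|)%N%:R = k%:R * (2 ^ k)%:R :> R.
    by rewrite -!natrM sum_card_subsets.
  by rewrite [2 * (_ - _)]mulrBr [2 * (_ * ln 2)]mulrA hc -[_ *+ (2 ^ k)]mulr_natl; lra.
by rewrite ler_pM2l //; apply: ler_sum => S _; exact: lindstrom_digits_ge.
Qed.

(** With [N] coordinates per block, [n %/ N + 1] blocks suffice; the summand [2 ^ k] pays for the
    rounding. *)
Lemma Psi_hamming_le_real (R : realType) n q k : (1 < q)%N ->
  0 < k%:R * ln 2 - 6 * ln q%:R :> R ->
  (Psi (@hamming_graph n q))%:R <=
    n%:R * (2 * ln q%:R / (k%:R * ln 2 - 6 * ln q%:R)) + (2 ^ k)%:R :> R.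
Proof.
move=> q1; set D := k%:R * ln 2 - 6 * ln q%:R => D0.
have lnq : 0 < ln q%:R :> R by rewrite ln_gt0 // ltr1n.
have := lindstrom_size_ge R k q1; rewrite -/D.
set N := lindstrom_size q k => hN.
have P0 : 0 < (2 ^ k)%:R :> R by rewrite ltr0n expn_gt0.
have N0 : 0 < N%:R :> R by have := mulr_gt0 P0 D0; nra.
have hn : (n <= (n %/ N).+1 * N)%N by rewrite ltnW // ltn_ceil // -(ltr0n R).
have := Psi_hamming_le q1 hn; rewrite -(ler_nat R) => /le_trans; apply.
rewrite mulSn addnC natrD lerD2r natrM.
apply: (@le_trans _ _ (n%:R / N%:R * (2 ^ k)%:R)).
  rewrite ler_pM2r // ler_pdivlMr // -natrM ler_nat; exact: leq_trunc_div.
rewrite -mulrA ler_wpM2l // mulrC ler_pdivrMr // mulrAC ler_pdivlMr //.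
lra.
Qed.

Lemma Psi_hamming_le_ln (R : realType) n q (L : R) :
  (1 < q)%N -> (0 < n)%N -> L = ln n%:R ->
  0 < L -> 0 < L - 4 * Num.sqrt L - (1 + 6 * ln q%:R) ->
  (Psi (@hamming_graph n q))%:R <=
    n%:R * (2 * ln q%:R / (L - 4 * Num.sqrt L - (1 + 6 * ln q%:R))) + n%:R / L ^+ 2.
Proof.
move=> q1 n0 LE L0; set D := L - _ - _ => D0.
have lnq : 0 < ln q%:R :> R by rewrite ln_gt0 // ltr1n.
have ln2 : 0 < ln 2 :> R by rewrite ln_gt0 // ltr1n.
have ln2_le1 : ln 2 <= 1 :> R by have := @le_ln1Dx R 1; apply; lra.
have nR : 0 < n%:R :> R by rewrite ltr0n.
have lnL : ln L <= 2 * Num.sqrt L.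
  have sL : 0 < Num.sqrt L by rewrite sqrtr_gt0.
  rewrite -{1}(sqr_sqrtr (ltW L0)) lnXn // mulr2n.
  have := ln_sublinear sL; lra.
(* [2 ^ k] is about [n / L ^+ 2]: one extra block is negligible against [n / L], while [k * ln 2]
   falls short of [L] by at most [2 * ln L + ln 2], hence by at most [4 * sqrt L + 1]. *)
pose k := Num.truncn ((L - 2 * ln L) / ln 2).
have k0 : 0 <= (L - 2 * ln L) / ln 2.
  by rewrite divr_ge0 // ?(ltW ln2) //; move: D0; rewrite /D; lra.
have /andP[] := truncn_itv k0; rewrite -/k ler_pdivlMr // ltr_pdivrMr // => k1.
rewrite -addn1 natrD mulrDl mul1r => k2.
have kD : D <= k%:R * ln 2 - 6 * ln q%:R by rewrite /D; lra.
have kD0 := lt_le_trans D0 kD.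
apply: le_trans (Psi_hamming_le_real n q1 kD0) _; apply: lerD.
  by rewrite ler_wpM2l // ler_wpM2l ?mulr_ge0 ?(ltW lnq) // lef_pV2 ?posrE.
rewrite -ler_ln ?posrE ?divr_gt0 ?exprn_gt0 ?ltr0n ?expn_gt0 //.
rewrite natrX lnXn ?ltr0n // ln_div ?posrE ?exprn_gt0 // lnXn // -LE.
by rewrite -[ln 2 *+ k]mulr_natl -[ln L *+ 2]mulr_natl.
Qed.

Local Open Scope classical_set_scope.

Lemma near_ln_gt (R : realType) (A : R) : \forall n \near \oo, A < ln (n%:R : R).
Proof.
exists (Num.truncn (expR A)).+1 => // n /= hn.
have hA : expR A < n%:R.
  by apply: lt_le_trans (truncnS_gt _) _; rewrite ler_nat.
by rewrite -[A]expRK ltr_ln ?posrE ?expR_gt0 // (lt_trans _ hA) ?expR_gt0.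
Qed.

Lemma cvg_inv_sqrt_ln (R : realType) :
  (Num.sqrt (ln (n%:R : R)))^-1 @[n --> \oo] --> (0 : R).
Proof.
apply/cvgrPdist_lt => e e0; near=> n.
have lnn : e ^- 2 < ln (n%:R : R) by near: n; exact: near_ln_gt.
have h : e^-1 < Num.sqrt (ln (n%:R : R)).
  rewrite -[e^-1]ger0_norm ?invr_ge0 ?ltW // -sqrtr_sqr exprVn ltr_sqrt //.
  by rewrite (lt_trans _ lnn) // invr_gt0 exprn_gt0.
have s0 : 0 < Num.sqrt (ln (n%:R : R)) by rewrite (lt_trans _ h) // invr_gt0.
rewrite sub0r normrN gtr0_norm ?invr_gt0 //.
by rewrite -[e]invrK ltf_pV2 ?posrE // invr_gt0.
Unshelve. all: by end_near.
Qed.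

Theorem theorem7 (R : realType) (q : nat) (hq : (2 <= q)%N) :
  exists eps : nat -> R,
    (eps n @[n --> \oo] --> (0 : R)) /\
    (\forall n \near \oo,
       (Psi (@hamming_graph n q))%:R =
         (2 + eps n) * (n%:R / log_base (q%:R : R) (n%:R : R))).
Proof.
pose L n : R := ln n%:R; pose z n : R := (Num.sqrt (L n))^-1.
pose c : R := 1 + 6 * ln q%:R; pose K : R := 3 + ln 4.
pose P n : R := (Psi (@hamming_graph n q))%:R.
have lnq : 0 < ln q%:R :> R by rewrite ln_gt0 // ltr1n.
(* The value forced by the equation; what remains is to squeeze it to 0. *)
exists (fun n => P n * (L n / (n%:R * ln q%:R)) - 2); split; last first.
  near=> n; rewrite /log_base -/(L n) -/(P n).
  have L0 : 0 < L n by near: n; exact: near_ln_gt.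
  have n0 : 0 < n%:R :> R by rewrite ltr0n; near: n; exact: nbhs_infty_gt.
  by field; rewrite !gt_eqF.
have z0 : z n @[n --> \oo] --> (0 : R) by exact: cvg_inv_sqrt_ln.
have z2 : z n ^+ 2 @[n --> \oo] --> (0 : R).
  by rewrite -(mul0r (0 : R)); under eq_fun do rewrite expr2; exact: cvgM.
(* The denominator of the upper bound is [L n * D n], and in terms of [z n] both bounds [lo] and
   [hi] below are continuous at 0. *)
pose D n := 1 - 4 * z n - c * z n ^+ 2.
have D1 : D n @[n --> \oo] --> (1 : R).
  have -> : 1 = 1 - 4 * 0 - c * 0 :> R by ring.
  apply: cvgB; last by apply: cvgM => //; exact: cvg_cst.
  apply: cvgB; first exact: cvg_cst.
  by apply: cvgM => //; exact: cvg_cst.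
pose lo n := 2 / (1 + 2 * K * z n ^+ 2) - 2.
pose hi n := 2 / D n + z n ^+ 2 / ln q%:R - 2.
apply: (@squeeze_cvgr _ _ _ _ lo hi).
- near=> n.
  have L0 : 0 < L n by near: n; exact: near_ln_gt.
  have Dn : 0 < D n by near: n; exact: (cvgr_gt 1).
  have n0 : (0 < n)%N by near: n; exact: nbhs_infty_gt.
  have nR : 0 < n%:R :> R by rewrite ltr0n.
  have s0 : 0 < Num.sqrt (L n) by rewrite sqrtr_gt0.
  have zE : z n ^+ 2 = (L n)^-1 by rewrite exprVn sqr_sqrtr // ltW.
  have DE : L n - 4 * Num.sqrt (L n) - c = L n * D n.
    have zs : z n * Num.sqrt (L n) = 1 by rewrite mulVf ?gt_eqF.
    have Ls := esym (sqr_sqrtr (ltW L0)).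
    have zL : z n * L n = Num.sqrt (L n) by rewrite {1}Ls expr2 mulrA zs mul1r.
    rewrite /D zE !mulrBr mulr1 mulrCA [L n * z n]mulrC zL.
    by rewrite mulrCA mulfV ?mulr1 ?gt_eqF.
  have K0 : 0 < K + L n / 2.
    by rewrite addr_gt0 ?divr_gt0 // addr_gt0 // ln_gt0 // ltr1n.
  rewrite !lerD2r; apply/andP; split.
    have := Psi_hamming_ge R hq n0; rewrite -/(P n) -/(L n) -/K => h.
    rewrite zE mulrA ler_pdivlMr ?mulr_gt0 //.
    have -> : 2 / (1 + 2 * K * (L n)^-1) = L n / (K + L n / 2).
      have hK : K * 2 + L n != 0 by apply: lt0r_neq0; lra.
      by field; rewrite hK gt_eqF.
    rewrite mulrAC ler_pdivrMr //; nra.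
  have := @Psi_hamming_le_ln R n q (L n) hq n0 erefl L0; rewrite -/c DE.
  move=> /(_ (mulr_gt0 L0 Dn)); rewrite -/(P n) => h.
  rewrite zE mulrA ler_pdivrMr ?mulr_gt0 //.
  have := ler_wpM2r (ltW L0) h; move/le_trans; apply.
  rewrite le_eqVlt; apply/orP; left; apply/eqP.
  by field; rewrite !gt_eqF.
- rewrite -(subrr (2 : R)); apply: cvgB; last exact: cvg_cst.
  rewrite -[X in _ --> X]divr1; apply: cvgM; first exact: cvg_cst.
  apply: cvgV; first exact: oner_neq0.
  rewrite -[X in _ --> X]addr0 -(mulr0 (2 * K)); apply: cvgD; first exact: cvg_cst.
  by apply: cvgM => //; exact: cvg_cst.
- rewrite -(subrr (2 : R)); apply: cvgB; last exact: cvg_cst.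
  rewrite -[X in _ --> X]addr0; apply: cvgD.
    rewrite -[X in _ --> X]divr1; apply: cvgM; first exact: cvg_cst.
    by apply: cvgV => //; exact: oner_neq0.
  by rewrite -(mul0r (ln q%:R)^-1); apply: cvgM => //; exact: cvg_cst.
Unshelve. all: by end_near.
Qed.
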